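(* Let $A\in\mathbb{C}^{m\times n}$, $W\in\mathbb{C}^{n\times m}$ and $k=\max\{\mathrm{ind}(AW),\mathrm{ind}(WA)\}$. Then there exists a unique $X\in\mathbb{C}^{m\times n}$ such that $$XW(AW)^{k+1}=(AW)^k,\quad AWXWX=X\quad\text{and}\quad (WAWX)^*=WAWX.$$ The unique $X$ which satisfies these equations is $X=A[(WA)^{\mathrm{cEP}}]^2$.
   Context: For a square complex matrix $B$, $\mathrm{ind}(B)$ is the smallest non-negative integer $j$ with $\mathrm{rank}(B^j)=\mathrm{rank}(B^{j+1})$ (with $B^0=I$). $B^*$ is the conjugate transpose. The core-EP inverse $B^{\mathrm{cEP}}$ of $B\in\mathbb{C}^{n\times n}$ is the unique $Y\in\mathbb{C}^{n\times n}$ with $YB^{j+1}=B^j$, $BY^2=Y$ and $(BY)^*=BY$, where $j=\mathrm{ind}(B)$. *)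

(* Defs.v *)
From HB Require Import structures.
From mathcomp Require Import all_boot all_order all_algebra.
From mathcomp Require Export reals.
From mathcomp.real_closed Require Export complex.
From mathcomp Require Export spectral.

Set Implicit Arguments.
Unset Strict Implicit.
Unset Printing Implicit Defensive.

Import Order.TTheory GRing.Theory Num.Theory.
Local Open Scope ring_scope.
Local Open Scope sesquilinear_scope.

Section Index.
Variables (F : fieldType) (n : nat).
Implicit Type B : 'M[F]_n.

Lemma mxindex_exists B : exists j, \rank (B ^+ j) == \rank (B ^+ j.+1).
Proof.
have rank_le j : (\rank (B ^+ j.+1) <= \rank (B ^+ j))%N.
  by rewrite exprS mxrankM_maxr.
have [/existsP [j Hj]|] :=
    boolP [exists j : 'I_n.+1, \rank (B ^+ j) == \rank (B ^+ j.+1)].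
  by exists j.
rewrite negb_exists => /forallP H.
have drop k : (k <= n.+1 -> \rank (B ^+ k) + k <= n)%N.
  elim: k => [_|k IHk lt_kn]; first by rewrite addn0 rank_leq_row.
  rewrite addnS (leq_trans _ (IHk (ltnW lt_kn))) // ltn_add2r.
  by rewrite ltn_neqAle rank_le eq_sym (H (Ordinal lt_kn)).
by have := drop n.+1 (leqnn _); rewrite addnS ltnNge leq_addl.
Qed.

Definition mxindex B : nat := ex_minn (mxindex_exists B).

End Index.

Section CoreEP.
Variable C : numClosedFieldType.

Lemma mx_normal_eq0 m n (V : 'M[C]_(m, n)) : V ^t* *m V = 0 -> V = 0.
Proof.
move=> /matrixP H; apply/matrixP => i j; have := H j j; rewrite !mxE.
move=> /psumr_eq0P H0; apply/eqP; rewrite -normr_eq0 -sqrf_eq0 normCKC.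
rewrite -(H0 _ i) ?mxE // => k _; rewrite !mxE -normCKC exprn_ge0 //.
Qed.

Lemma ctrmx_mul m n p (U : 'M[C]_(m, n)) (V : 'M[C]_(n, p)) :
  (U *m V) ^t* = V ^t* *m U ^t*.
Proof. by rewrite trmx_mul map_mxM. Qed.

Lemma herm_projector n (M : 'M[C]_n) :
  exists2 Z, (M *m Z) ^t* = M *m Z & M *m Z *m M = M.
Proof.
have : (M <= M ^t* *m M)%MS.
  rewrite submxE; set K := cokermx _; apply/eqP/mx_normal_eq0.
  by rewrite ctrmx_mul -!mulmxA (mulmxA (M ^t*)) mulmx_coker mulmx0.
case/submxP => D DM; exists (D ^t*).
  by rewrite ctrmx_mul trmxCK {1 2}DM ctrmx_mul ctrmx_mul trmxCK !mulmxA.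
have MD : M ^t* *m M *m D ^t* = M ^t* by rewrite {3}DM !ctrmx_mul trmxCK.
have H : (M *m D ^t*) ^t* = M *m D ^t*.
  by rewrite ctrmx_mul trmxCK {1 2}DM ctrmx_mul ctrmx_mul trmxCK !mulmxA.
by rewrite -H ctrmx_mul trmxCK -mulmxA -DM.
Qed.

Variable n : nat.
Implicit Types B Y : 'M[C]_n.

Definition is_cEP B Y : bool :=
  [&& Y *m B ^+ (mxindex B).+1 == B ^+ mxindex B,
      B *m Y ^+ 2 == Y &
      (B *m Y) ^t* == B *m Y].

Lemma mxindex_factor B (j := mxindex B) :
  (exists D, B ^+ j = D *m B ^+ j.+1) /\ (exists E, B ^+ j = B ^+ j.+1 *m E).
Proof.
have rk : \rank (B ^+ j) = \rank (B ^+ j.+1).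
  by rewrite /j /mxindex; case: ex_minnP => i /eqP.
have le1 : (B ^+ j.+1 <= B ^+ j)%MS by rewrite exprS submxMl.
have le2 : ((B ^+ j.+1)^T <= (B ^+ j)^T)%MS by rewrite exprSr trmx_mul submxMl.
split; first by apply/submxP; rewrite -(geq_leqif (mxrank_leqif_sup le1)) rk.
have /submxP[E HE] : ((B ^+ j)^T <= (B ^+ j.+1)^T)%MS.
  by rewrite -(geq_leqif (mxrank_leqif_sup le2)) !mxrank_tr rk.
by exists E^T; apply: trmx_inj; rewrite trmx_mul trmxK.
Qed.

Lemma cEP_exists B : exists Y, is_cEP B Y.
Proof.
have [[D HD] [E HE]] := mxindex_factor B.
have [Z herm pM] := herm_projector (B ^+ mxindex B).
rewrite /is_cEP; move: (mxindex B) HD HE herm pM => j.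
rewrite !mulmxE => HD HE herm pM.
have BY : B * (B ^+ j * E * Z) = B ^+ j * Z by rewrite !mulrA -exprS -HE.
have YE : B ^+ j * E * Z = D * (B ^+ j * Z).
  by rewrite {1}HD exprS -BY !mulrA.
exists (B ^+ j * E * Z); rewrite expr2 ?mulmxE mulrA BY herm eqxx andbT.
apply/andP; split; last by rewrite !mulrA pM.
by rewrite YE exprSr -mulrA (mulrA _ _ B) pM -exprSr -HD.
Qed.

Lemma cEP_unique B Y1 Y2 : is_cEP B Y1 -> is_cEP B Y2 -> Y1 = Y2.
Proof.
have [_ [E HE]] := mxindex_factor B.
rewrite /is_cEP; move: (mxindex B) HE => j.
rewrite !mulmxE => HE /and3P[/eqP a1 /eqP b1 /eqP c1] /and3P[/eqP a2 /eqP b2 /eqP c2].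
have iterY Y i : B * Y ^+ 2 = Y -> B ^+ i * Y ^+ i.+1 = Y.
  move=> HY; elim: i => [|i IHi]; first by rewrite mul1r.
  rewrite exprSr (exprD Y 2 i) -mulrA (mulrA B) HY -exprS //.
have projM Y : Y * B ^+ j.+1 = B ^+ j -> B * Y * B ^+ j = B ^+ j.
  by move=> HY; rewrite {1}HE mulrA -(mulrA B) HY -exprS -HE.
have cross Y Y' : Y * B ^+ j.+1 = B ^+ j -> B * Y' ^+ 2 = Y' ->
    B * Y * (B * Y') = B * Y'.
  move=> HY HY'; rewrite -[in B * Y'](iterY Y' j HY') (mulrA B (B ^+ j)).
  by rewrite -exprS exprSr -(mulrA (B ^+ j)) mulrA projM.
have P12 : B * Y1 = B * Y2.
  by rewrite -c1 -(cross _ _ a2 b1) -mulmxE ctrmx_mul !mulmxE c1 c2 cross.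
have YBY Y Y' : Y * B ^+ j.+1 = B ^+ j -> B * Y' ^+ 2 = Y' ->
    Y * (B * Y') = Y'.
  move=> HY HY'; rewrite -[in LHS](iterY Y' j HY') (mulrA B) -exprS mulrA HY.
  exact: iterY.
by rewrite -(YBY _ _ a1 b1) P12 YBY.
Qed.

Definition cEP B : 'M[C]_n := xchoose (cEP_exists B).

Lemma cEPP B : is_cEP B (cEP B).
Proof. exact: xchooseP. Qed.

End CoreEP.

(* Main.v *)
Require Import Defs.
From mathcomp Require Import all_boot all_order all_algebra.
From mathcomp Require Import reals spectral.
From mathcomp.real_closed Require Import complex.
Import Order.TTheory GRing.Theory Num.Theory.
Local Open Scope ring_scope.
Local Open Scope sesquilinear_scope.

(** Write [B = W A] and [M = A W]. The equations for [X] are those of the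
    core-EP inverse of [B] in disguise. If [X] solves them, then [Y = W X]
    satisfies [B Y = W A W X] (Hermitian), [B Y^2 = W (A W X W X) = Y] and
    [Y B^(k+1) = B^k], so [Y] is the core-EP inverse of [B], and
    [X = A (W X) (W X) = A Y^2]. Conversely, for [Y] the core-EP inverse of
    [B], [X = A Y^2] gives [W X = B Y^2 = Y], whence [A W X W X = A Y^2 = X]
    and [W A W X = B Y] is Hermitian.

    The delicate point is the exponent. Moving a power across [W] turns
    [W M^i] into [B^i W], so a power of [B] becomes a power of [M] only after
    one factor has been spent ([B^(i+1) = W M^i A]), and a power equation for
    one product yields the equation for the other at an exponent too large
    by one. As [k] bounds both indices, every [k]-th power can be
    divided on the right by as many further factors as needed
    ([expr_right_factor]), which brings the exponent back down to [k]; these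
    are [cEP_power_swap] and [weighted_power_swap]. The same
    division shows that the power equation of the core-EP inverse may be
    imposed at any exponent above the index ([cEP_exponent]). *)

Lemma mulmx_expr_swap (R : pzSemiRingType) m n (A : 'M[R]_(m, n))
    (W : 'M[R]_(n, m)) i :
  W *m (A *m W) ^+ i = (W *m A) ^+ i *m W.
Proof.
elim: i => [|i IHi]; first by rewrite !expr0 mulmx1 mul1mx.
by rewrite !exprS -!mulmxE -!mulmxA IHi.
Qed.

Section AboveIndex.
Variables (C : numClosedFieldType) (n : nat).
Implicit Types B Y : 'M[C]_n.

(** From the index on, all powers have the same column space. *)
Lemma expr_right_factor B i d : (mxindex B <= i)%N ->
  exists E, B ^+ i = B ^+ (i + d) *m E.
Proof.
move=> le_ji; elim: d => [|d [E HE]].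
  by exists 1%:M; rewrite addn0 mulmx1.
have [_ [D HD]] := mxindex_factor B.
have HD' : B ^+ (i + d) = B ^+ (i + d).+1 *m D.
  have le_jid : (mxindex B <= i + d)%N by rewrite (leq_trans le_ji) ?leq_addr.
  rewrite -(subnK le_jid) -addnS !exprD -!mulmxE -mulmxA.
  by rewrite {1}HD.
by exists (D *m E); rewrite addnS mulmxA -HD'.
Qed.

Lemma cEP_exponent B Y k : (mxindex B <= k)%N ->
  (Y *m B ^+ (mxindex B).+1 = B ^+ mxindex B) <-> (Y *m B ^+ k.+1 = B ^+ k).
Proof.
move=> le_jk; split=> HY.
  by rewrite -(subnKC le_jk) -addSn !exprD -!mulmxE mulmxA HY.
have [E HE] := expr_right_factor B _ (k - mxindex B) (leqnn _).
rewrite subnKC // in HE.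
by rewrite exprS -mulmxE HE !mulmxA -(mulmxA Y) mulmxE -exprS -mulmxE HY.
Qed.

Lemma cEP_characterization B Y k : (mxindex B <= k)%N ->
  Y = cEP B <-> [/\ Y *m B ^+ k.+1 = B ^+ k, B *m Y ^+ 2 = Y &
                    (B *m Y) ^t* = B *m Y].
Proof.
move=> le_jk; split=> [->|[pY sY hY]].
  have /and3P[/eqP pC /eqP sC /eqP hC] := cEPP B.
  by split=> //; apply/(cEP_exponent _ _ _ le_jk).
apply: (@cEP_unique _ _ B); last exact: cEPP.
by apply/and3P; split; apply/eqP => //; apply/(cEP_exponent _ _ _ le_jk).
Qed.

End AboveIndex.
Arguments expr_right_factor {C n B i} d.
Arguments cEP_characterization {C n B} Y {k}.

Section Weighted.
Variables (C : numClosedFieldType) (m n : nat).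
Variables (A : 'M[C]_(m, n)) (W : 'M[C]_(n, m)).

(** Spending the factor [B^(k+1) = W M^k A] would require the hypothesis at
    exponent [k - 1]; dividing [B^k] by [B] first makes room for it. *)
Lemma cEP_power_swap (X : 'M[C]_(m, n)) k : (mxindex (W *m A) <= k)%N ->
  X *m W *m (A *m W) ^+ k.+1 = (A *m W) ^+ k ->
  W *m X *m (W *m A) ^+ k.+1 = (W *m A) ^+ k.
Proof.
move=> le_k HX; have [E HE] := expr_right_factor 1 le_k.
have BS i : (W *m A) ^+ i.+1 = W *m (A *m W) ^+ i *m A.
  by rewrite mulmx_expr_swap exprSr -mulmxE mulmxA.
have -> : (W *m A) ^+ k.+1 = (W *m A) ^+ k.+2 *m E.
  by rewrite exprS -mulmxE HE addn1 mulmxA mulmxE -exprS.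
rewrite [RHS]HE addn1 !BS !mulmxA.
by rewrite -(mulmxA W X) -(mulmxA W (X *m W)) HX.
Qed.

Lemma weighted_power_swap (Y : 'M[C]_n) k : (mxindex (A *m W) <= k)%N ->
  Y *m (W *m A) ^+ k.+1 = (W *m A) ^+ k ->
  A *m Y ^+ 2 *m W *m (A *m W) ^+ k.+1 = (A *m W) ^+ k.
Proof.
move=> le_k HY; have [E HE] := expr_right_factor 1 le_k.
have -> : (A *m W) ^+ k.+1 = (A *m W) ^+ k.+2 *m E.
  by rewrite exprS -mulmxE HE addn1 mulmxA mulmxE -exprS.
have Y2 : Y ^+ 2 *m (W *m A) ^+ k.+2 = (W *m A) ^+ k.
  by rewrite expr2 exprSr -!mulmxE -mulmxA (mulmxA Y _ (W *m A)) HY mulmxE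
             -exprSr -mulmxE HY.
rewrite [RHS]HE addn1 mulmxA -(mulmxA (A *m _)) mulmx_expr_swap.
rewrite mulmxA -(mulmxA A) Y2 -(mulmxA A) -mulmx_expr_swap.
by rewrite mulmxA mulmxE -exprS.
Qed.

End Weighted.

Theorem theorem2p2 (R : realType) (m n : nat)
    (A : 'M[R[i]]_(m, n)) (W : 'M[R[i]]_(n, m)) :
  let k := maxn (mxindex (A *m W)) (mxindex (W *m A)) in
  let sol := fun X : 'M[R[i]]_(m, n) =>
    [/\ X *m W *m (A *m W) ^+ k.+1 = (A *m W) ^+ k,
        A *m W *m X *m W *m X = X &
        (W *m A *m W *m X) ^t* = W *m A *m W *m X] in
  (exists! X : 'M[R[i]]_(m, n), sol X) /\
  (forall X : 'M[R[i]]_(m, n), sol X <-> X = A *m cEP (W *m A) ^+ 2).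
Proof.
move=> k sol.
have le_M : (mxindex (A *m W) <= k)%N by rewrite leq_maxl.
have le_B : (mxindex (W *m A) <= k)%N by rewrite leq_maxr.
have solP X : sol X <-> X = A *m cEP (W *m A) ^+ 2.
  split=> [[pX sX hX]|->].
    have <- : W *m X = cEP (W *m A).
      apply/(cEP_characterization _ le_B).
      split; first exact: cEP_power_swap.
        by rewrite expr2 -mulmxE -[in RHS]sX !mulmxA.
      by rewrite mulmxA.
    by rewrite expr2 -mulmxE -[LHS]sX !mulmxA.
  have [] := (cEP_characterization _ le_B).1 (erefl (cEP (W *m A))).
  move: (cEP _) => Y pY sY hY.
  have WX : W *m (A *m Y ^+ 2) = Y by rewrite mulmxA sY.
  split; first exact: weighted_power_swap.
    by rewrite -(mulmxA A W) WX -(mulmxA _ W) WX -mulmxA mulmxE -expr2.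
  by rewrite -(mulmxA _ W) WX.
split=> //; exists (A *m cEP (W *m A) ^+ 2); split; first exact/solP.
by move=> X /solP ->.
Qed.
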